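(* For each $k\in\{8,9,10\}$, the formal power series \[ F_{k,1}(q)=\sum_{n\ge 0}\frac{\left(q^{2n+2};q^2\right)_\infty\left(q^{2n+2k};q^2\right)_\infty}{\left(q^{2n+1};q^2\right)_\infty^2}\,q^{2n+1} \] has nonnegative coefficients, i.e. all coefficients of $q^n$, $n\in\mathbb{N}_0$, in $F_{k,1}(q)$ are $\ge 0$.
   Context: For $n\in\mathbb{N}_0\cup\{\infty\}$, $(a;q)_n:=\prod_{j=0}^{n-1}(1-aq^j)$. The series $F_{k,1}(q)$ is regarded as a formal power series in $q$. *)

(* Defs.v *)
From HB Require Import structures.
From mathcomp Require Import all_boot all_order all_algebra.
From mathcomp Require Import boolp classical_sets.

Set Implicit Arguments.
Unset Strict Implicit.
Unset Printing Implicit Defensive.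

Import Order.TTheory GRing.Theory Num.Theory.
Local Open Scope ring_scope.

Declare Scope fps_scope.
Delimit Scope fps_scope with fps.

(* {fps R} is the ring R[[q]]; coefn f i is the coefficient of q^i in f. *)
Record fps (R : Type) := Fps { coefn : nat -> R }.

Notation "{ 'fps' R }" := (fps R) (at level 0, format "{ 'fps'  R }").

Lemma fpsP (R : Type) (f g : {fps R}) : coefn f =1 coefn g <-> f = g.
Proof.
split=> [|-> //]; case: f g => [f] [g] /= fg.
by congr Fps; apply/funext.
Qed.

HB.instance Definition _ (R : Type) := gen_eqMixin {fps R}.
HB.instance Definition _ (R : Type) := gen_choiceMixin {fps R}.

Section Zmodule.
Variable R : zmodType.
Implicit Types f g h : {fps R}.

Definition fps_zero : {fps R} := Fps (fun=> 0).
Definition fps_opp f : {fps R} := Fps (fun i => - coefn f i).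
Definition fps_add f g : {fps R} := Fps (fun i => coefn f i + coefn g i).

Lemma fps_addA : associative fps_add.
Proof. by move=> f g h; apply/fpsP => i /=; rewrite addrA. Qed.
Lemma fps_addC : commutative fps_add.
Proof. by move=> f g; apply/fpsP => i /=; rewrite addrC. Qed.
Lemma fps_add0 : left_id fps_zero fps_add.
Proof. by move=> f; apply/fpsP => i /=; rewrite add0r. Qed.
Lemma fps_addN : left_inverse fps_zero fps_opp fps_add.
Proof. by move=> f; apply/fpsP => i /=; rewrite addNr. Qed.

HB.instance Definition _ :=
  GRing.isZmodule.Build {fps R} fps_addA fps_addC fps_add0 fps_addN.

Lemma coefn0 i : coefn (0 : {fps R}) i = 0. Proof. by []. Qed.
Lemma coefnD f g i : coefn (f + g) i = coefn f i + coefn g i.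
Proof. by []. Qed.
Lemma coefnN f i : coefn (- f) i = - coefn f i. Proof. by []. Qed.
Lemma coefnB f g i : coefn (f - g) i = coefn f i - coefn g i.
Proof. by []. Qed.
Lemma coefn_sum (I : Type) (r : seq I) (P : pred I) (F : I -> {fps R}) i :
  coefn (\sum_(j <- r | P j) F j) i = \sum_(j <- r | P j) coefn (F j) i.
Proof. exact: (big_morph (fun f => coefn f i) (fun f g => coefnD f g i)). Qed.
End Zmodule.

Section Ring.
Variable R : comNzRingType.
Implicit Types f g h : {fps R}.

Definition fps_one : {fps R} := Fps (fun i => (i == 0)%:R).
Definition fps_mul f g : {fps R} :=
  Fps (fun i => \sum_(j < i.+1) coefn f j * coefn g (i - j)).

Definition fps_trunc n f : {poly R} := \poly_(i < n) coefn f i.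

Lemma coef_fps_trunc n f i : (i < n)%N -> (fps_trunc n f)`_i = coefn f i.
Proof. by rewrite coef_poly => ->. Qed.

Lemma coefn_mul_trunc n f g i : (i < n)%N ->
  coefn (fps_mul f g) i = (fps_trunc n f * fps_trunc n g)`_i.
Proof.
move=> lin; rewrite coefM /=; apply: eq_bigr => j _; rewrite !coef_fps_trunc //.
  exact: leq_ltn_trans (leq_subr _ _) lin.
by apply: leq_trans lin; apply: ltn_ord.
Qed.

Lemma fps_mulC : commutative fps_mul.
Proof.
by move=> f g; apply/fpsP => i; rewrite !(coefn_mul_trunc _ _ (ltnSn i)) mulrC.
Qed.

Lemma fps_mulA : associative fps_mul.
Proof.
move=> f g h; apply/fpsP => i.
transitivity ((fps_trunc i.+1 f * (fps_trunc i.+1 g * fps_trunc i.+1 h))`_i).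
  rewrite coefM; apply: eq_bigr => j _.
  rewrite coef_fps_trunc // (coefn_mul_trunc _ _ (n := i.+1)) //.
  by rewrite ltnS leq_subr.
rewrite mulrA coefM; apply: eq_bigr => j _.
by rewrite (coef_fps_trunc h) ?ltnS ?leq_subr// (coefn_mul_trunc _ _ (n := i.+1)).
Qed.

Lemma fps_mul1 : left_id fps_one fps_mul.
Proof.
move=> f; apply/fpsP => i /=; rewrite big_ord_recl /= mul1r subn0 big1 ?addr0 //.
by move=> j _; rewrite mul0r.
Qed.

Lemma fps_mulDl : left_distributive fps_mul +%R.
Proof.
move=> f g h; apply/fpsP => i; rewrite coefnD /= -big_split /=.
by apply: eq_bigr => j _; rewrite mulrDl.
Qed.

Lemma fps_one_neq0 : fps_one != 0.
Proof.
apply/eqP => /fpsP/(_ 0) /eqP; rewrite coefn0 /=.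
by rewrite oner_eq0.
Qed.

HB.instance Definition _ := GRing.Zmodule_isComNzRing.Build {fps R}
  fps_mulA fps_mulC fps_mul1 fps_mulDl fps_one_neq0.

(* The indeterminate q. *)
Definition fpsX : {fps R} := Fps (fun i => (i == 1)%:R).

Lemma coefn1 i : coefn (1 : {fps R}) i = (i == 0)%:R. Proof. by []. Qed.
Lemma coefnM f g i :
  coefn (f * g) i = \sum_(j < i.+1) coefn f j * coefn g (i - j).
Proof. by []. Qed.

Lemma coefnXM f i :
  coefn (fpsX * f) i = if i is j.+1 then coefn f j else 0.
Proof.
rewrite coefnM; case: i => [|i]; first by rewrite big_ord1 /= mul0r.
rewrite !big_ord_recl /= mul0r add0r mul1r subSS subn0 big1 ?addr0 // => j _.
by rewrite mul0r.
Qed.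

Lemma coefnXnM n f i :
  coefn (fpsX ^+ n * f) i = if (i < n)%N then 0 else coefn f (i - n).
Proof.
elim: n i => [|n IHn] i; first by rewrite mul1r subn0.
by rewrite exprS -mulrA coefnXM; case: i => // i; rewrite IHn.
Qed.
End Ring.

Notation "''q'" := (fpsX _) : fps_scope.

Section Unit.
Variable R : comUnitRingType.
Implicit Types f g : {fps R}.

(* The first n coefficients of the inverse of f, from the Cauchy product. *)
Fixpoint fps_inv_prefix f n : seq R :=
  if n is m.+1 then
    let s := fps_inv_prefix f m in
    rcons s ((coefn f 0)^-1 *
             ((m == 0)%:R - \sum_(j < m) coefn f (m - j) * s`_j))
  else [::].

Definition fps_unit : pred {fps R} := fun f => coefn f 0 \is a GRing.unit.
Definition fps_inv f : {fps R} :=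
  if fps_unit f then Fps (fun i => (fps_inv_prefix f i.+1)`_i) else f.

Lemma size_fps_inv_prefix f n : size (fps_inv_prefix f n) = n.
Proof. by elim: n => //= n IHn; rewrite size_rcons IHn. Qed.

Lemma nth_fps_inv_prefix f n i : (i < n)%N ->
  (fps_inv_prefix f n)`_i = (fps_inv_prefix f i.+1)`_i.
Proof.
elim: n => // n IHn; rewrite ltnS leq_eqVlt => /predU1P [-> //|lin].
by rewrite [in LHS]/= nth_rcons size_fps_inv_prefix lin IHn.
Qed.

Lemma fps_mulVr : {in fps_unit, left_inverse 1 fps_inv *%R}.
Proof.
move=> f Uf; rewrite mulrC; apply/fpsP => i; rewrite coefnM coefn1.
rewrite /fps_inv; have -> : fps_unit f by [].
rewrite (reindex_inj rev_ord_inj) /= big_ord_recr /= subnn.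
rewrite nth_rcons size_fps_inv_prefix ltnn eqxx mulrA subn0 divrr //.
rewrite mul1r addrC -[RHS](subrK (\sum_(j < i) coefn f (i - j) *
  (fps_inv_prefix f i)`_j)); congr (_ + _).
apply: eq_bigr => j _; rewrite subSS; congr (_ * _).
by rewrite subKn 1?ltnW // [RHS](nth_fps_inv_prefix f (ltn_ord j)).
Qed.

Lemma fps_unitP f g : g * f = 1 -> fps_unit f.
Proof.
move=> /fpsP/(_ 0); rewrite coefnM big_ord1 coefn1 /= => gf1.
by apply/unitrPr; exists (coefn g 0); rewrite mulrC.
Qed.

Lemma fps_inv_out : {in [predC fps_unit], fps_inv =1 id}.
Proof. by move=> f; rewrite /fps_inv inE => /negbTE; rewrite -topredE /= => ->. Qed.

HB.instance Definition _ := GRing.ComNzRing_hasMulInverse.Build {fps R}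
  fps_mulVr fps_unitP fps_inv_out.

Lemma unit_fpsE f : (f \is a GRing.unit) = (coefn f 0 \is a GRing.unit).
Proof. by []. Qed.
End Unit.

Section Limit.
Variable R : zmodType.
Implicit Types (u : nat -> {fps R}) (l : {fps R}).

(* Convergence in the q-adic topology, R being discrete. *)
Definition fps_cvg u l :=
  forall i, exists N, forall n, (N <= n)%N -> coefn (u n) i = coefn l i.

(* The limit of u for fps_cvg; a coefficient that does not stabilise is sent
   to 0. *)
Definition fps_lim u : {fps R} :=
  Fps (fun i => xget 0 [set c : R |
    exists N, forall n, (N <= n)%N -> coefn (u n) i = c]).

Definition fps_series u : {fps R} := fps_lim (fun N => \sum_(n < N) u n).

Lemma fps_cvg_lim u l : fps_cvg u l -> fps_lim u = l.
Proof.
move=> ul; apply/fpsP => i /=; have [N uN] := ul i.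
case: xgetP => [c _ [M uM]|/(_ (coefn l i))]; last by case; exists N.
by rewrite -(uM (maxn M N)) ?leq_maxl // uN ?leq_maxr.
Qed.

Lemma fps_lim_cvg u :
    (forall i, exists N, forall n, (N <= n)%N ->
       coefn (u n.+1) i = coefn (u n) i) ->
  fps_cvg u (fps_lim u).
Proof.
move=> ust i /=; apply: (@xgetPex R 0 [set c : R |
  exists N, forall n, (N <= n)%N -> coefn (u n) i = c]).
have [N uN] := ust i; exists (coefn (u N) i), N => n; elim: n => [|n IHn].
  by rewrite leqn0 => /eqP <-.
rewrite leq_eqVlt => /predU1P [-> //|]; rewrite ltnS => Nn.
by rewrite uN // IHn.
Qed.
End Limit.

Section QPochhammer.
Variable R : comNzRingType.

(* (a; p)_n and (a; p)_oo *)
Definition qpoch (a p : {fps R}) (n : nat) : {fps R} :=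
  \prod_(j < n) (1 - a * p ^+ j).
Definition qpoch_oo (a p : {fps R}) : {fps R} := fps_lim (qpoch a p).

Lemma qpochS (a p : {fps R}) n :
  qpoch a p n.+1 = qpoch a p n * (1 - a * p ^+ n).
Proof. by rewrite /qpoch big_ord_recr. Qed.

Lemma coefn_mulXn_lt (f : {fps R}) n i :
  (i < n)%N -> coefn (f * fpsX R ^+ n) i = 0.
Proof. by move=> lin; rewrite mulrC coefnXnM lin. Qed.

Lemma qpoch_cvg m :
  fps_cvg (qpoch (fpsX R ^+ m) (fpsX R ^+ 2))
          (qpoch_oo (fpsX R ^+ m) (fpsX R ^+ 2)).
Proof.
apply: fps_lim_cvg => i; exists i.+1 => n lin.
rewrite qpochS mulrBr mulr1 coefnB -exprM -exprD.
rewrite coefn_mulXn_lt ?subr0 //; apply: leq_trans lin _.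
by rewrite mul2n -addnn addnA leq_addl.
Qed.
End QPochhammer.

Local Open Scope fps_scope.

Definition F_term (k n : nat) : {fps int} :=
  qpoch_oo ('q ^+ (2 * n + 2)) ('q ^+ 2) *
  qpoch_oo ('q ^+ (2 * n + 2 * k)) ('q ^+ 2) /
  qpoch_oo ('q ^+ (2 * n + 1)) ('q ^+ 2) ^+ 2 * 'q ^+ (2 * n + 1).

Definition F_k1 (k : nat) : {fps int} := fps_series (F_term k).

(* No junk value enters F_k1: besides qpoch_cvg, the denominators are units
   and the series converges. *)
Lemma F_denominator_unit (n : nat) :
  (qpoch_oo ('q ^+ (2 * n + 1)) ('q ^+ 2) : {fps int}) \is a GRing.unit.
Proof.
rewrite unit_fpsE; have [N /(_ N (leqnn N)) <-] := qpoch_cvg int (2 * n + 1) 0.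
elim: N => [|N IHN]; first by rewrite /qpoch big_ord0 unitr1.
rewrite qpochS coefnM big_ord1 unitrM IHN coefnB -exprM -exprD.
by rewrite -[_ ^+ _]mul1r coefn_mulXn_lt ?subr0 ?coefn1 ?unitr1 // addn1.
Qed.

Lemma F_k1_cvg (k : nat) : fps_cvg (fun N => \sum_(n < N) F_term k n) (F_k1 k).
Proof.
apply: fps_lim_cvg => i; exists i.+1 => n lin.
rewrite big_ord_recr coefnD /F_term coefn_mulXn_lt ?addr0 //.
by apply: leq_trans lin _; rewrite mul2n -addnn addn1 leqW // leq_addl.
Qed.

(* Main.v *)
(* Heine's transformation (expand one quotient of infinite products by the
   q-binomial theorem, exchange the two sums, and resum) gives
     F_{k,1}(q) = 1/(q;q^2)_{k-1} * sum_(r >= 0) q^(r+1) (q^(2r+3);q^2)_{k-2}.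
   Expanding (q^(2r+3);q^2)_{k-2} in powers of q^(2r) turns the sum into
   geometric series, so F_{k,1} is a rational function with all poles at roots
   of unity. For k = 8, 9, 10 there are k exponents e_i for which
   N = F_{k,1} * prod_i (1 - q^(e_i)) is a polynomial whose few negative
   coefficients can be cancelled by subtracting terms c q^a (1 - q^(e_i)) with
   c > 0; each such term stays nonnegative after division by the product, and
   so does the remainder, whose coefficients are nonnegative. *)
From Stdlib Require Import BinInt.
Require Import Defs.
From mathcomp Require Import all_boot all_order all_algebra.
From mathcomp Require Import ring zify ssrZ.
Set Implicit Arguments.
Unset Strict Implicit.
Unset Printing Implicit Defensive.
Import Order.TTheory GRing.Theory Num.Theory.
Local Open Scope ring_scope.

(** * Order of vanishing and sums of summable families *)

Section FpsOrder.
Variable R : comNzRingType.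
Implicit Types (f g h : {fps R}) (u v : nat -> {fps R}).

Definition fps_vanish n f := forall i, (i < n)%N -> coefn f i = 0.

Lemma fps_vanish_sub0 f g : (forall n, fps_vanish n (f - g)) -> f = g.
Proof.
move=> fg; apply/fpsP => i; apply/eqP; rewrite -subr_eq0 -coefnB.
by rewrite (fg i.+1).
Qed.

Lemma fps_vanishD n f g :
  fps_vanish n f -> fps_vanish n g -> fps_vanish n (f + g).
Proof. by move=> f0 g0 i lin; rewrite coefnD f0 // g0 // addr0. Qed.

Lemma fps_vanishN n f : fps_vanish n f -> fps_vanish n (- f).
Proof. by move=> f0 i lin; rewrite coefnN f0 // oppr0. Qed.

Lemma fps_vanishMl n f g : fps_vanish n f -> fps_vanish n (f * g).
Proof.
move=> f0 i lin; rewrite coefnM big1 // => j _; rewrite f0 ?mul0r //.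
exact: leq_ltn_trans (leq_ord j) lin.
Qed.

Lemma fps_vanishMr n f g : fps_vanish n g -> fps_vanish n (f * g).
Proof. by rewrite mulrC; apply: fps_vanishMl. Qed.

Lemma fps_vanish_le m n f : (m <= n)%N -> fps_vanish n f -> fps_vanish m f.
Proof. by move=> lmn f0 i lim; apply: f0; apply: leq_trans lmn. Qed.

Lemma fps_vanishXn n m : (n <= m)%N -> fps_vanish n (fpsX R ^+ m).
Proof.
move=> lnm i lin; rewrite -[_ ^+ _]mulr1 coefnXnM.
by rewrite (leq_trans lin lnm).
Qed.

Definition fps_summable u := forall n, fps_vanish n (u n).

(** For a summable family the terms past n = i do not reach the coefficient of q^i, so the finite
    cut-off loses nothing and limits are avoided. *)
Definition fps_sum u : {fps R} :=
  Fps (fun i => \sum_(n < i.+1) coefn (u n) i).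

Lemma coefn_fps_sum u i N : fps_summable u -> (i < N)%N ->
  coefn (fps_sum u) i = \sum_(n < N) coefn (u n) i.
Proof.
move=> su; elim: N => // N IHN; rewrite ltnS leq_eqVlt => /predU1P [-> //|liN].
by rewrite big_ord_recr /= -IHN // (su N) // addr0.
Qed.

Lemma fps_seriesE u : fps_summable u -> fps_series u = fps_sum u.
Proof.
move=> su; apply: fps_cvg_lim => i; exists i.+1 => n lin.
by rewrite Defs.coefn_sum (coefn_fps_sum su lin).
Qed.

Lemma eq_fps_sum u v : u =1 v -> fps_sum u = fps_sum v.
Proof. by move=> uv; apply/fpsP => i /=; apply: eq_bigr => n _; rewrite uv. Qed.

Lemma fps_sumB u v : fps_sum (fun n => u n - v n) = fps_sum u - fps_sum v.
Proof. by apply/fpsP => i; rewrite coefnB /= -sumrB. Qed.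

Lemma fps_sumMl f u : fps_summable u ->
  fps_sum (fun n => f * u n) = f * fps_sum u.
Proof.
move=> su; apply/fpsP => i; rewrite coefnM.
transitivity (\sum_(n < i.+1) \sum_(j < i.+1) coefn f j * coefn (u n) (i - j)).
  by [].
rewrite exchange_big /=; apply: eq_bigr => j _; rewrite -mulr_sumr.
by rewrite -(coefn_fps_sum su) // ltnS leq_subr.
Qed.

Lemma fps_sum_recl u : fps_summable u ->
  fps_sum u = u 0 + fps_sum (fun n => u n.+1).
Proof.
(* Splitting off [u 0] leaves i + 1 shifted terms, so the left sum is first lengthened to i + 2
   terms; the extra one vanishes at q^i. *)
move=> su; apply/fpsP => i; rewrite coefnD (@coefn_fps_sum u i i.+2 su) //.
by rewrite big_ord_recl.
Qed.

(** At q^i both sides are the same finite sum over the square m, n <= i. *)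
Lemma fps_sum_exchange (w : nat -> nat -> {fps R}) :
  fps_sum (fun m => fps_sum (w m)) = fps_sum (fun n => fps_sum (w^~ n)).
Proof. by apply/fpsP => i /=; rewrite exchange_big. Qed.

Lemma fps_summableMXn u (e : nat -> nat) :
  (forall n, (n <= e n)%N) -> fps_summable (fun n => u n * fpsX R ^+ e n).
Proof. by move=> le n; apply: fps_vanishMr; apply: fps_vanishXn. Qed.

Lemma fps_vanish_sum N u :
  (forall n, fps_vanish N (u n)) -> fps_vanish N (fps_sum u).
Proof. by move=> u0 i liN; rewrite /= big1 // => n _; apply: u0. Qed.

End FpsOrder.

(** * Infinite products in base q^2 and the q-binomial theorem *)

Section InfiniteProduct.
Variable R : comUnitRingType.
Local Notation q := (fpsX R).

Definition qprod m : {fps R} := qpoch_oo (q ^+ m) (q ^+ 2).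

Lemma qpoch0 (a p : {fps R}) : qpoch a p 0 = 1.
Proof. by rewrite /qpoch big_ord0. Qed.

Lemma qpochSl m n : qpoch (q ^+ m) (q ^+ 2) n.+1 =
  (1 - q ^+ m) * qpoch (q ^+ (m + 2)) (q ^+ 2) n.
Proof.
rewrite /qpoch big_ord_recl expr0 mulr1; congr (_ * _); apply: eq_bigr => i _.
by rewrite exprD -mulrA -exprS.
Qed.

Lemma qprodS m : qprod m = (1 - q ^+ m) * qprod (m + 2).
Proof.
apply/fpsP => i.
(* Multiplying by 1 - q^m involves the coefficients i and i - m of the tail, hence three
   stabilisation bounds. *)
have [N1 h1] := qpoch_cvg R m i; have [N2 h2] := qpoch_cvg R (m + 2) i.
have [N3 h3] := qpoch_cvg R (m + 2) (i - m)%N.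
pose n := maxn N1 (maxn N2 N3); rewrite -(h1 n.+1) /n; last lia.
rewrite qpochSl !mulrBl !mul1r !coefnB h2; last lia.
by rewrite !coefnXnM h3 //; lia.
Qed.

Lemma qprod_split m n :
  qprod m = qpoch (q ^+ m) (q ^+ 2) n * qprod (m + 2 * n).
Proof.
elim: n m => [|n IHn] m; first by rewrite qpoch0 mul1r muln0 addn0.
rewrite qprodS IHn qpochSl mulrA; congr (_ * qprod _); lia.
Qed.

Lemma qpoch_vanish m n : fps_vanish m (qpoch (q ^+ m) (q ^+ 2) n - 1).
Proof.
elim: n => [|n IHn]; first by rewrite qpoch0 subrr.
rewrite qpochS mulrBr mulr1 addrAC; apply: fps_vanishD => //.
by apply/fps_vanishN/fps_vanishMr/fps_vanishMl/fps_vanishXn.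
Qed.

Lemma qprod_vanish m : fps_vanish m (qprod m - 1).
Proof.
move=> i lim; have [N /(_ N (leqnn N))] := qpoch_cvg R m i.
by rewrite coefnB => <-; rewrite -coefnB qpoch_vanish.
Qed.

Lemma fps_vanish_unit m (f : {fps R}) :
  fps_vanish m.+1 (f - 1) -> f \is a GRing.unit.
Proof.
move=> /(_ 0 isT)/eqP; rewrite coefnB subr_eq0 unit_fpsE => /eqP->.
by rewrite coefn1 unitr1.
Qed.

Lemma one_sub_Xn_unit e : (0 < e)%N -> 1 - q ^+ e \is a GRing.unit.
Proof.
move=> e0; apply: (@fps_vanish_unit 0); rewrite addrAC subrr add0r.
exact/fps_vanishN/fps_vanishXn.
Qed.

Lemma qprod_unit m : qprod m.+1 \is a GRing.unit.
Proof. exact/fps_vanish_unit/qprod_vanish. Qed.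

Lemma qpoch_unit m n : qpoch (q ^+ m.+1) (q ^+ 2) n \is a GRing.unit.
Proof. exact/fps_vanish_unit/qpoch_vanish. Qed.

Definition qbin_coef t r : {fps R} :=
  qpoch (q ^+ t) (q ^+ 2) r / qpoch (q ^+ 2) (q ^+ 2) r.

(** The basic hypergeometric series 1phi0 in base q^2, with parameter q^t and argument q^s. *)
Definition qbin_series t s : {fps R} :=
  fps_sum (fun r => qbin_coef t r * q ^+ (s * r)).

Lemma fps_summable_mulXn (f : nat -> {fps R}) s : (0 < s)%N ->
  fps_summable (fun r => f r * q ^+ (s * r)).
Proof. by move=> s0; apply: fps_summableMXn => n; apply: leq_pmull. Qed.

Lemma qbin_coefS t r :
  qbin_coef t r.+1 * (1 - q ^+ (2 * r + 2)) =
  qbin_coef t r * (1 - q ^+ (t + 2 * r)).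
Proof.
rewrite /qbin_coef !qpochS -!exprM -!exprD [(2 * r + 2)%N]addnC.
have U : 1 - q ^+ (2 + 2 * r) \is a GRing.unit by apply: one_sub_Xn_unit.
by rewrite invrM ?qpoch_unit // mulrA [LHS]mulrAC mulrVK // mulrAC.
Qed.

(** The functional equation (1 - z) G(z) = (1 - az) G(q^2 z) at z = q^s, a = q^t. In G(z) - G(q^2 z)
    the r-th coefficient gains the factor 1 - q^(2r), which [qbin_coefS] trades for the preceding
    coefficient. *)
Lemma qbin_seriesS t s : (0 < s)%N ->
  (1 - q ^+ s) * qbin_series t s = (1 - q ^+ (s + t)) * qbin_series t (s + 2).
Proof.
move=> s0; suff: qbin_series t s - qbin_series t (s + 2) =
    q ^+ s * qbin_series t s - q ^+ (s + t) * qbin_series t (s + 2).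
  move=> E; apply/eqP; rewrite -subr_eq0; move/eqP: E; rewrite -subr_eq0 => /eqP E.
  by apply/eqP; rewrite -E; ring.
rewrite /qbin_series -fps_sumB fps_sum_recl; last first.
  move=> n; apply: fps_vanishD; first exact: fps_summable_mulXn.
  by apply/fps_vanishN; apply: fps_summable_mulXn => //; rewrite addn2.
rewrite !muln0 subrr add0r -!fps_sumMl; try by apply: fps_summable_mulXn; rewrite ?addn2.
rewrite -fps_sumB; apply: eq_fps_sum => r.
transitivity (qbin_coef t r.+1 * (1 - q ^+ (2 * r + 2)) * q ^+ (s * r.+1)).
  rewrite mulrBr mulr1 mulrBl -[_ * _ ^+ (2 * r + 2) * _]mulrA -exprD.
  by congr (_ - _ * _ ^+ _); lia.
rewrite qbin_coefS mulrBr mulr1 mulrBl -[_ * _ ^+ (t + 2 * r) * _]mulrA.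
rewrite [q ^+ s * _]mulrCA [q ^+ (s + t) * _]mulrCA -!exprD.
by congr (_ * _ ^+ _ - _ * _ ^+ _); lia.
Qed.

Lemma qbin_series_qpoch t s n : (0 < s)%N ->
  qpoch (q ^+ s) (q ^+ 2) n * qbin_series t s =
  qpoch (q ^+ (s + t)) (q ^+ 2) n * qbin_series t (s + 2 * n).
Proof.
move=> s0; elim: n => [|n IHn]; first by rewrite !qpoch0 muln0 addn0.
rewrite !qpochS mulrAC IHn mulrAC -!mulrA; congr (_ * _).
rewrite -!exprM -!exprD mulrC [_ * (1 - _)]mulrC qbin_seriesS ?addn_gt0 ?s0 //.
by congr ((1 - _ ^+ _) * qbin_series _ _); lia.
Qed.

Lemma qbin_series_vanish t s : fps_vanish s (qbin_series t s.+1 - 1).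
Proof.
rewrite /qbin_series fps_sum_recl; last exact: fps_summable_mulXn.
rewrite /qbin_coef !qpoch0 divr1 muln0 mul1r expr0 addrAC subrr add0r.
apply: fps_vanish_sum => n; apply/fps_vanishMr/fps_vanishXn; nia.
Qed.

(** Iterating the functional equation n times leaves tails congruent to 1 modulo q^n; n is
    arbitrary. *)
Lemma q_binomial_theorem t s : (0 < s)%N ->
  qbin_series t s = qprod (s + t) / qprod s.
Proof.
case: s => // s _; apply: (mulIr (qprod_unit s)); rewrite mulrVK ?qprod_unit //.
apply: fps_vanish_sub0 => n.
pose a := qprod (s.+1 + t + 2 * n); pose b := qbin_series t (s.+1 + 2 * n).
pose c := qprod (s.+1 + 2 * n).
have E : qbin_series t s.+1 * qprod s.+1 * a = qprod (s.+1 + t) * (b * c).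
  rewrite (qprod_split s.+1 n) (qprod_split (s.+1 + t) n) -/a -/c.
  rewrite [qbin_series _ _ * _]mulrA [qbin_series _ _ * _]mulrC.
  rewrite qbin_series_qpoch // -/b.
  by ring.
(* By [E], the difference is a combination of a - 1, b - 1 and c - 1, each of which vanishes to
   order n. *)
have -> : qbin_series t s.+1 * qprod s.+1 - qprod (s.+1 + t) =
    - (a - 1) * (qbin_series t s.+1 * qprod s.+1) +
    qprod (s.+1 + t) * ((b - 1) * c + (c - 1)).
  apply/eqP; rewrite -subr_eq0; apply/eqP.
  transitivity (qbin_series t s.+1 * qprod s.+1 * a - qprod (s.+1 + t) * (b * c)).
    by ring.
  by rewrite E subrr.
have le_b : fps_vanish n (b - 1).
  by apply: fps_vanish_le (@qbin_series_vanish t (s + 2 * n)); lia.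
have le_a : fps_vanish n (a - 1).
  by apply: fps_vanish_le (@qprod_vanish (s.+1 + t + 2 * n)); lia.
have le_c : fps_vanish n (c - 1).
  by apply: fps_vanish_le (@qprod_vanish (s.+1 + 2 * n)); lia.
apply: fps_vanishD; first exact/fps_vanishMl/fps_vanishN.
by apply/fps_vanishMr/fps_vanishD => //; apply: fps_vanishMl.
Qed.

End InfiniteProduct.

(** * Heine's transformation of F_{k,1} *)

Section Heine.
Local Notation q := (fpsX int).
Local Notation P := (qprod int).

Lemma F_term_summable k : fps_summable (F_term k).
Proof. by apply: fps_summableMXn => n; lia. Qed.

(** One quotient of infinite products is a constant times a q-binomial coefficient; the other is
    expanded by the q-binomial theorem with parameter q^(2k-1). *)
Lemma F_term_double k n : (0 < k)%N ->
  F_term k n = fps_sum (fun r => P 2 / P 1 *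
    (qbin_coef int 1 n * qbin_coef int (2 * k - 1) r *
       q ^+ ((2 * n + 1) * (r + 1)))).
Proof.
move=> k0; have Ub : P (1 + 2 * n) \is a GRing.unit by apply: qprod_unit.
have E1 : P (2 * n + 2) / P (2 * n + 1) = P 2 / P 1 * qbin_coef int 1 n.
  rewrite (qprod_split int 2 n) (qprod_split int 1 n) /qbin_coef.
  rewrite ![(2 * n + _)%N]addnC.
  have := qpoch_unit int 1 n; have := qpoch_unit int 0 n; move: Ub.
  move: (P (1 + _)) (P (2 + _)) => x y.
  move: (qpoch (q ^+ 1) _ _) (qpoch (q ^+ 2) _ _) => a b Ux Ua Ub.
  rewrite invrM //.
  transitivity ((b / b) * (a^-1 * a) * (y / x)); last by ring.
  by rewrite divrr // mulVr // !mul1r.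
have E2 : P (2 * n + 2 * k) / P (2 * n + 1) =
    qbin_series int (2 * k - 1) (2 * n + 1).
  by rewrite q_binomial_theorem ?addn1 //; congr (P _ / _); lia.
have -> : F_term k n = (P (2 * n + 2) / P (2 * n + 1)) *
    (P (2 * n + 2 * k) / P (2 * n + 1)) * q ^+ (2 * n + 1).
  rewrite /F_term -/(P (2 * n + 2)) -/(P (2 * n + 2 * k)) -/(P (2 * n + 1)).
  rewrite -exprVn; move: (P _) (P _)^-1 (P _) (q ^+ _) => a b c d; ring.
rewrite E1 E2 mulrAC -fps_sumMl; last by apply: fps_summable_mulXn; rewrite addn1.
apply: eq_fps_sum => r; rewrite mulnDr muln1 [q ^+ (_ * r + _)]exprD.
move: (q ^+ (2 * n + 1)) (q ^+ (_ * r)) (qbin_coef _ _ _) (qbin_coef _ _ _).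
by move: (P 2 / P 1) => a b c d e; ring.
Qed.

(** Once finite factors are split off, only the products starting at q^(2r+2) and q^(2m+3+2r) remain
    infinite, and both cancel. *)
Lemma Heine_term m r :
  P 2 / P 1 * (qbin_coef int (2 * m + 3) r *
    (P (2 * r + 3) / P (2 * r + 2))) =
  (qpoch (q ^+ 1) (q ^+ 2) m.+1)^-1 * qpoch (q ^+ (2 * r + 3)) (q ^+ 2) m.
Proof.
rewrite /qbin_coef (qprod_split int 1 m.+1) (qprod_split int (2 * r + 3) m).
rewrite (qprod_split int 2 r) [(2 + 2 * r)%N]addnC.
have -> : (1 + 2 * m.+1 = 2 * m + 3)%N by lia.
rewrite (qprod_split int (2 * m + 3) r).
have -> : (2 * r + 3 + 2 * m = 2 * m + 3 + 2 * r)%N by lia.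
have := qpoch_unit int 1 r; have := qpoch_unit int 0 m.+1.
have := qpoch_unit int (2 * m + 2) r; rewrite -addnS.
have := qprod_unit int (2 * r + 1); rewrite -addnS.
have := qprod_unit int (2 * m + 2 + 2 * r); rewrite -addSn -addnS.
move: (P (2 * m + 3 + 2 * r)) (P (2 * r + 2)) => z y.
move: (qpoch (q ^+ 2) _ r) (qpoch (q ^+ (2 * m + 3)) _ r) => b A.
move: (qpoch _ _ m.+1) (qpoch _ _ m) => D C Uz Uy UA UD Ub.
rewrite !invrM ?unitrM ?UA ?Uz //.
transitivity ((y / y) * (b / b) * (A / A) * (z / z) * (D^-1 * C)); first by ring.
by rewrite !divrr // !mul1r.
Qed.

(** After the exchange, the inner sum over n is again a 1phi0, now with parameter q and argument
    q^(2r+2). *)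
Lemma F_k1_Heine m :
  F_k1 m.+2 = (qpoch (q ^+ 1) (q ^+ 2) m.+1)^-1 * q *
    fps_sum (fun r => qpoch (q ^+ (2 * r + 3)) (q ^+ 2) m * q ^+ (1 * r)).
Proof.
have -> : F_k1 m.+2 = fps_sum (F_term m.+2).
  exact: fps_seriesE (@F_term_summable _).
rewrite (eq_fps_sum (fun n => @F_term_double m.+2 n isT)) fps_sum_exchange.
rewrite -fps_sumMl; last exact: fps_summable_mulXn.
apply: eq_fps_sum => r.
transitivity (P 2 / P 1 * (qbin_coef int (2 * m + 3) r *
    (P (2 * r + 3) / P (2 * r + 2))) * q ^+ (r + 1)); last first.
  rewrite Heine_term mul1n addn1 [q ^+ r.+1]exprS.
  by move: (qpoch _ _ m) (_^-1) (q ^+ r) => a b c; ring.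
have -> : P (2 * r + 3) / P (2 * r + 2) = qbin_series int 1 (2 * r + 2).
  by rewrite q_binomial_theorem ?addn2 //; congr (P _ / _); lia.
have -> : (2 * m.+2 - 1 = 2 * m + 3)%N by lia.
rewrite mulrA mulrAC -fps_sumMl; last by apply: fps_summable_mulXn; rewrite addn2.
apply: eq_fps_sum => n.
have -> : ((2 * n + 1) * (r + 1) = (r + 1) + (2 * r + 2) * n)%N by lia.
rewrite exprD; move: (q ^+ (r + 1)) (q ^+ (_ * n)) (P 2 / P 1).
by move: (qbin_coef _ _ _) (qbin_coef _ _ _) => a b c d e; ring.
Qed.

End Heine.

(** * Recurrence for the transformed sum *)

Section Rational.
Local Notation q := (fpsX int).

(** The transformed sum is the case j = 0. Expanding the last factor of the product yields a q^(2n),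
    which raises j by one, so the family is closed under recursion on m. *)
Definition qpoch_series m j : {fps int} :=
  fps_sum (fun n => qpoch (q ^+ (2 * n + 3)) (q ^+ 2) m * q ^+ ((2 * j + 1) * n)).

Lemma qpoch_series0 j : qpoch_series 0 j * (1 - q ^+ (2 * j + 1)) = 1.
Proof.
have S : fps_summable (fun n => q ^+ ((2 * j + 1) * n)).
  by move=> n; apply: fps_vanishXn; rewrite addn1 leq_pmull.
pose g := fps_sum (fun n => q ^+ ((2 * j + 1) * n)).
have -> : qpoch_series 0 j = g.
  by apply: eq_fps_sum => n; rewrite qpoch0 mul1r.
suff E : g = 1 + q ^+ (2 * j + 1) * g by rewrite mulrBr mulr1 {1}E mulrC addrK.
rewrite {1}/g (fps_sum_recl S) muln0 expr0 -fps_sumMl //; congr (_ + _).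
by apply: eq_fps_sum => n; rewrite -exprD mulnS.
Qed.

Lemma qpoch_seriesS m j :
  qpoch_series m.+1 j =
  qpoch_series m j - q ^+ (2 * m + 3) * qpoch_series m j.+1.
Proof.
rewrite -fps_sumMl; last by apply: fps_summable_mulXn; rewrite addn1.
rewrite -fps_sumB; apply: eq_fps_sum => n.
rewrite qpochS mulrBr mulr1 mulrBl; congr (_ - _).
rewrite -exprM -exprD -mulrA -exprD mulrCA -exprD.
by congr (_ * _ ^+ _); lia.
Qed.

End Rational.

(** * Computable polynomial arithmetic on coefficient lists *)

Section PolynomialLists.
Local Notation q := (fpsX int).

(** Entries are binary integers so that the final certificates can be evaluated. *)
Definition fps_of_list (a : seq Z) : {fps int} :=
  Fps (fun i => int_of_Z (nth Z0 a i)).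

Fixpoint psub (a b : seq Z) : seq Z :=
  match a, b with
  | x :: a', y :: b' => Z.sub x y :: psub a' b'
  | _, [::] => a
  | [::], _ => map Z.opp b
  end.

Definition pshift n (a : seq Z) : seq Z := nseq n Z0 ++ a.

Definition pmul1 e (a : seq Z) : seq Z := psub a (pshift e a).

(* The quotient by 1 - q^e as a series truncated to the length of a. It only
   produces candidates, which nonneg_cert checks by multiplying back. *)
Definition pdiv1 e (a : seq Z) : seq Z :=
  rev (foldl (fun b x => Z.add x (nth Z0 b e.-1) :: b) [::] a).

Lemma fps_of_psub a b : fps_of_list (psub a b) = fps_of_list a - fps_of_list b.
Proof.
apply/fpsP => i; rewrite coefnB /=.
elim: a b i => [|x a IHa] [|y b] [|i] //=; try by lia.
by elim: b {y} i => [|y b IHb] [|i] //=; lia.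
Qed.

Lemma fps_of_pshift n a : fps_of_list (pshift n a) = q ^+ n * fps_of_list a.
Proof.
apply/fpsP => i; rewrite coefnXnM /= nth_cat size_nseq nth_nseq.
by case: ltnP.
Qed.

Lemma fps_of_pmul1 e a :
  fps_of_list (pmul1 e a) = (1 - q ^+ e) * fps_of_list a.
Proof. by rewrite fps_of_psub fps_of_pshift mulrBl mul1r. Qed.

Definition geom_prod (es : seq nat) : {fps int} := \prod_(e <- es) (1 - q ^+ e).

Lemma fps_of_foldr_pmul1 es a :
  fps_of_list (foldr pmul1 a es) = geom_prod es * fps_of_list a.
Proof.
elim: es => [|e es IHes] /=; first by rewrite /geom_prod big_nil mul1r.
by rewrite fps_of_pmul1 IHes /geom_prod big_cons mulrA.
Qed.

Lemma fps_of_list_eq a b :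
  all (Z.eqb 0) (psub a b) -> fps_of_list a = fps_of_list b.
Proof.
move=> /all_nthP z; apply/eqP; rewrite -subr_eq0 -fps_of_psub; apply/eqP/fpsP.
move=> i; rewrite coefn0 /=; case: (ltnP i (size (psub a b))) => [lt|ge].
  by move: (z Z0 _ lt) => /Z.eqb_eq <-.
by rewrite nth_default.
Qed.

(* The numerator of qpoch_series m j over (q^(2j+1); q^2)_(m+1). *)
Fixpoint pnum m j : seq Z :=
  if m is m'.+1 then
    psub (pmul1 (2 * (j + m'.+1) + 1) (pnum m' j))
         (pshift (2 * m' + 3) (pmul1 (2 * j + 1) (pnum m' j.+1)))
  else [:: Z.of_nat 1].

(** Over the common denominator (q^(2j+1);q^2)_(m+2), the first series of the recurrence lacks the
    last factor and the second lacks the first one. *)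
Lemma fps_of_pnum m j :
  fps_of_list (pnum m j) =
  qpoch_series m j * qpoch (q ^+ (2 * j + 1)) (q ^+ 2) m.+1.
Proof.
elim: m j => [|m IHm] j.
  rewrite qpochS qpoch0 mul1r expr0 mulr1 qpoch_series0.
  by apply/fpsP => -[|[|i]].
rewrite /= fps_of_psub fps_of_pshift !fps_of_pmul1 !IHm qpoch_seriesS.
set D := qpoch _ _ m.+2.
have D1 : D = qpoch (q ^+ (2 * j + 1)) (q ^+ 2) m.+1 *
    (1 - q ^+ (2 * (j + m.+1) + 1)).
  rewrite /D qpochS -exprM -exprD; congr (_ * (1 - _ ^+ _)); lia.
have D2 : D = (1 - q ^+ (2 * j + 1)) *
    qpoch (q ^+ (2 * j.+1 + 1)) (q ^+ 2) m.+1.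
  rewrite /D qpochSl; congr (_ * qpoch (_ ^+ _) _ _); lia.
rewrite [RHS]mulrBl {1}D1 D2.
have ring_id (a b c d e f g : {fps int}) :
  b * (d * f) - c * (a * (e * g)) = d * (f * b) - c * e * (a * g) by ring.
exact: ring_id.
Qed.

End PolynomialLists.

(** * Nonnegativity certificates *)

Section Nonnegativity.
Local Notation q := (fpsX int).

Definition fps_nonneg (f : {fps int}) := forall i, 0 <= coefn f i.

Lemma fps_nonnegD f g : fps_nonneg f -> fps_nonneg g -> fps_nonneg (f + g).
Proof. by move=> f0 g0 i; rewrite coefnD addr_ge0. Qed.

Lemma fps_nonnegM f g : fps_nonneg f -> fps_nonneg g -> fps_nonneg (f * g).
Proof. by move=> f0 g0 i; rewrite coefnM sumr_ge0 // => j _; rewrite mulr_ge0. Qed.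

(** The inverse satisfies f = 1 + q^e f, so strong induction on the index applies. *)
Lemma fps_nonneg_geom e : (0 < e)%N -> fps_nonneg (1 - q ^+ e)^-1.
Proof.
move=> e0; set f := _^-1; have E : f = 1 + q ^+ e * f.
  apply: (mulrI (one_sub_Xn_unit int e0)).
  by rewrite mulrDr mulr1 mulrCA /f divrr ?one_sub_Xn_unit // mulr1 subrK.
move=> i; have [n] := ubnP i; elim: n i => // n IHn i lin; rewrite E coefnD coefnXnM.
rewrite addr_ge0 ?coefn1 ?ler0n //; case: ltnP => // lei.
by apply: IHn; lia.
Qed.

Lemma geom_prod_unit es : all (leq 1) es -> geom_prod es \is a GRing.unit.
Proof.
elim: es => [|e es IHes] /=; first by rewrite /geom_prod big_nil unitr1.
by case/andP=> e0 es0; rewrite /geom_prod big_cons unitrM one_sub_Xn_unit ?IHes.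
Qed.

Lemma fps_nonneg_geom_prod es : all (leq 1) es -> fps_nonneg (geom_prod es)^-1.
Proof.
elim: es => [|e es IHes] /=; rewrite /geom_prod ?big_nil ?big_cons.
  by rewrite invr1 => _ i; rewrite coefn1 ler0n.
case/andP=> e0 es0; rewrite invrM ?one_sub_Xn_unit ?geom_prod_unit //.
exact/fps_nonnegM/fps_nonneg_geom/e0/IHes.
Qed.

Lemma fps_nonneg_list a : all (Z.leb 0) a -> fps_nonneg (fps_of_list a).
Proof.
move=> /all_nthP a0 i /=; case: (ltnP i (size a)) => [/(a0 Z0)|ge]; first by lia.
by rewrite nth_default.
Qed.

(* The list cs encodes the sum of the terms c q^a (1 - q^e) over (a, e, c) in
   cs: when e is in es, such a term divided by geom_prod es is nonnegative
   although its own coefficients are not. *)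
Definition premove (N : seq Z) (cs : seq (nat * nat * nat)) : seq Z :=
  foldl (fun N c => psub N (pshift c.1.1 (pmul1 c.1.2 [:: Z.of_nat c.2]))) N cs.

Lemma fps_nonneg_div_geom_prod es cs N :
  all (leq 1) es -> all (fun c => c.1.2 \in es) cs ->
  all (Z.leb 0) (premove N cs) ->
  fps_nonneg (fps_of_list N / geom_prod es).
Proof.
move=> es0; elim: cs N => [|[[a e] c] cs IHcs] N /=.
  move=> _ N0; exact/fps_nonnegM/fps_nonneg_geom_prod/es0/fps_nonneg_list.
case/andP=> es_e cs_es /(IHcs _ cs_es); set M := pshift _ _.
rewrite fps_of_psub mulrBl => /fps_nonnegD N0.
rewrite -[X in fps_nonneg X](subrK (fps_of_list M / geom_prod es)); apply: N0.
rewrite fps_of_pshift fps_of_pmul1.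
(* [rem] deletes a single occurrence, so a repeated exponent loses just one factor, the one that
   cancels against the removed term. *)
have -> : geom_prod es = (1 - q ^+ e) * geom_prod (rem e es).
  by rewrite /geom_prod (perm_big _ (perm_to_rem es_e)) big_cons.
have es'0 : all (leq 1) (rem e es).
  by apply/allP => x /mem_rem xes; apply: (allP es0).
have e0 : (0 < e)%N by apply: (allP es0).
rewrite invrM ?one_sub_Xn_unit ?geom_prod_unit //.
have -> (x y z t : {fps int}) : x * (y * z) * (t / y) = x * z * t * (y / y) by ring.
rewrite divrr ?one_sub_Xn_unit // mulr1 -fps_of_pshift.
apply/fps_nonnegM/fps_nonneg_geom_prod => //; apply: fps_nonneg_list.
by rewrite all_cat all_nseq orbT /= andbT; lia.
Qed.

(** The odd exponents [ds] are divided out twice: (q;q^2)_(m+1) is both Heine's prefactor and the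
    denominator of [qpoch_series m 0]. The [pshift 1] is the factor q of q^(r+1). *)
Definition nonneg_cert m (es : seq nat) (cs : seq (nat * nat * nat)) :=
  let ds := [seq (2 * i + 1)%N | i <- iota 0 m.+1] in
  let X := foldr pmul1 (pshift 1 (pnum m 0)) es in
  let N := foldr pdiv1 X (ds ++ ds) in
  [&& all (Z.eqb Z0) (psub X (foldr pmul1 N (ds ++ ds))), all (leq 1) es,
      all (fun c => c.1.2 \in es) cs & all (Z.leb Z0) (premove N cs)].

Lemma F_k1_nonneg m es cs : nonneg_cert m es cs -> fps_nonneg (F_k1 m.+2).
Proof.
rewrite /nonneg_cert; set ds := map _ _; set X := foldr _ _ es.
set N := foldr pdiv1 _ _; case/and4P=> /fps_of_list_eq EX es0 cs_es N0.
suff -> : F_k1 m.+2 = fps_of_list N / geom_prod es.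
  exact: (fps_nonneg_div_geom_prod es0 cs_es N0).
pose D := qpoch (q ^+ 1) (q ^+ 2) m.+1.
have UD : D \is a GRing.unit := qpoch_unit _ _ _.
have Eds : geom_prod ds = D.
  rewrite /geom_prod big_map -[iota _ _]/(index_iota 0 m.+1) big_mkord.
  by apply: eq_bigr => i _; rewrite -exprM -exprD addnC.
(* Clearing all denominators turns the claim into the checked identity [EX]. *)
apply: (mulIr (geom_prod_unit es0)); rewrite mulrVK ?geom_prod_unit //.
apply: (mulIr UD); apply: (mulIr UD).
move: EX; rewrite !fps_of_foldr_pmul1 /geom_prod big_cat -/(geom_prod ds) Eds.
rewrite -/(geom_prod es) fps_of_pshift fps_of_pnum -/D expr1 F_k1_Heine -/D.
rewrite -/(qpoch_series m 0); set H := qpoch_series m 0 => EX.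
transitivity (D * D * fps_of_list N); last by ring.
rewrite -EX; transitivity (geom_prod es * (q * (H * D)) * (D^-1 * D)); first by ring.
by rewrite mulVr // mulr1.
Qed.

End Nonnegativity.

Unset Implicit Arguments.

Theorem theorem1p3 (k : nat) (hk : k \in [:: 8; 9; 10]%N) (n : nat) :
  0 <= coefn (F_k1 k) n.
Proof.
(* The exponents are chosen so that the product has at every root of unity at
   least the order of the pole of F_k1 there, with equality at 1 so that N(1) > 0.
   The triples come from a computer search matching each negative coefficient
   of N at a + e with a positive one at a. *)
move: k hk n => k; rewrite !inE => /or3P [] /eqP->.
- apply: (@F_k1_nonneg 6 [:: 9; 11; 11; 13; 13; 21; 35; 45]
    [:: (93, 9, 1); (95, 9, 1); (97, 9, 1); (98, 35, 1); (99, 9, 2);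
        (100, 11, 1); (101, 9, 1); (123, 13, 1); (125, 9, 2)]%N).
  by vm_compute.
- apply: (@F_k1_nonneg 7 [:: 1; 9; 11; 13; 15; 15; 63; 65; 77]
    [:: (163, 63, 1); (176, 63, 1); (191, 9, 1); (193, 13, 1); (196, 1, 2);
        (198, 15, 2); (202, 1, 1); (205, 1, 2); (207, 1, 1); (209, 1, 1);
        (209, 9, 1); (212, 1, 1); (221, 11, 1); (225, 1, 1); (233, 1, 1);
        (241, 1, 1); (243, 1, 1); (253, 1, 1)]%N).
  by vm_compute.
- apply: (@F_k1_nonneg 8 [:: 9; 13; 13; 15; 15; 17; 17; 55; 63; 77]
    [:: (178, 55, 1); (184, 55, 2); (185, 55, 4); (187, 55, 1); (193, 9, 2);
        (200, 13, 1); (201, 9, 2); (204, 9, 2); (215, 9, 1); (216, 15, 1);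
        (221, 17, 1); (223, 9, 2); (223, 13, 1); (225, 9, 2); (225, 13, 1);
        (226, 9, 2); (227, 9, 2); (251, 17, 1); (252, 9, 1); (253, 9, 2);
        (255, 9, 2)]%N).
  by vm_compute.
Qed.
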